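(* Let $\alpha\in\mathbb{N}_0$, let $n\ge 0$ be an integer and let $x\in\mathbb{R}$. Then the Fubini-type polynomials satisfy $$a_n^{(\alpha)}(x)=2^{\alpha}\sum_{k=0}^{n}\binom{n}{k}\sum_{i=0}^{k}\langle -2\alpha\rangle_i(-1)^iS(k,i)\,x^{n-k},$$ the Fubini-type numbers $a_n^{(\alpha)}=a_n^{(\alpha)}(0)$ satisfy $$a_n^{(\alpha)}=2^{\alpha}\sum_{i=0}^{n}\langle -2\alpha\rangle_i(-1)^iS(n,i),$$ and the generalized Apostol-Euler polynomials satisfy $$E_n^{(2\alpha)}(x;-1/2)=2^{4\alpha}\sum_{k=0}^{n}\binom{n}{k}\sum_{i=0}^{k}\langle -2\alpha\rangle_i(-1)^iS(k,i)\,x^{n-k}.$$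
   Context: For $\alpha\in\mathbb{N}_0$ the Fubini-type polynomials $a_n^{(\alpha)}(x)$ are defined by $$\frac{2^{\alpha}}{(2-e^{t})^{2\alpha}}e^{xt}=\sum_{n=0}^{\infty}a_n^{(\alpha)}(x)\frac{t^n}{n!},\qquad |t|<\log 2.$$ The generalized Apostol-Euler polynomials $E_n^{(\beta)}(x;\gamma)$ of order $\beta$ are defined (for $t$ near $0$) by $$\left(\frac{2}{\gamma e^{t}+1}\right)^{\beta}e^{xt}=\sum_{n=0}^{\infty}E_n^{(\beta)}(x;\gamma)\frac{t^n}{n!}.$$ $\langle y\rangle_i=y(y-1)\cdots(y-i+1)$ for $i\ge1$, $\langle y\rangle_0=1$, is the falling factorial. $S(n,k)$ are the Stirling numbers of the second kind, $\frac{(e^t-1)^k}{k!}=\sum_{n\ge k}S(n,k)\frac{t^n}{n!}$. The convention $0^0=1$ is used. *)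

(* Defs.v *)
From Stdlib Require Import Reals Factorial ClassicalEpsilon.
From Coquelicot Require Import Coquelicot.
Open Scope R_scope.

(* [egf_at a f t]: the exponential generating series sum_n a_n t^n / n!
   converges at t, with sum f t. *)
Definition egf_at (a : nat -> R) (f : R -> R) (t : R) : Prop :=
  is_pseries (fun n => a n / INR (fact n)) t (f t).

(* The sequence satisfying [P]. It is used below only for conditions [P] that
   determine the sequence, by existence and uniqueness of the power series
   expansion at 0. *)
Definition the_seq (P : (nat -> R) -> Prop) : nat -> R :=
  epsilon (inhabits (fun _ => 0)) P.

Definition fubini_poly (alpha n : nat) (x : R) : R :=
  the_seq (fun a => forall t, Rabs t < ln 2 ->
    egf_at a (fun t => 2 ^ alpha / (2 - exp t) ^ (2 * alpha) * exp (x * t)) t) n.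

Definition fubini_number (alpha n : nat) : R := fubini_poly alpha n 0.

(* The order [beta] is a natural number, so that the power is unambiguous
   whatever the sign of [gamma * exp t + 1]. For [gamma = -1], [beta > 0] the generating
   function has a pole at 0 and the value is meaningless. *)
Definition apostol_euler (beta n : nat) (x gamma : R) : R :=
  the_seq (fun a => locally 0 (fun t =>
    egf_at a (fun t => (2 / (gamma * exp t + 1)) ^ beta * exp (x * t)) t)) n.

(* The first conjunct expresses that the series starts at n = k. *)
Definition stirling2 (n k : nat) : R :=
  the_seq (fun s => (forall m, (m < k)%nat -> s m = 0) /\
    forall t, egf_at s (fun t => (exp t - 1) ^ k / INR (fact k)) t) n.

Fixpoint falling (y : R) (i : nat) : R :=
  match i with
  | O => 1
  | S j => falling y j * (y - INR j)
  end.

(* Main.v *)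
Require Import Defs.
From Stdlib Require Import Reals.
From Coquelicot Require Import Coquelicot.
From Stdlib Require Import Factorial Wf_nat Lra Lia ClassicalEpsilon.
Open Scope R_scope.

(** Put u = e^t - 1.  Then 1 / (2 - e^t)^m = (1 - u)^(-m), and the binomial
    series expands it in powers of u, whose Taylor coefficients are the
    S(n, i) i! / n!.  The rearranged coefficients T_m satisfy
    T_(m+1) = T_m + u T_(m+1) as power series (Pascal's rule), and this
    recurrence both bounds T_m(n) s^n for every s < ln 2, where e^s - 1 < 1,
    and identifies the sum of the series.  The claim follows by uniqueness of
    power series expansions. *)

(** * Finite sums *)

Lemma sum_f_R0_exchange (f : nat -> nat -> R) (N M : nat) :
  sum_f_R0 (fun k => sum_f_R0 (f k) M) N =
  sum_f_R0 (fun i => sum_f_R0 (fun k => f k i) N) M.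
Proof.
  induction N as [|N IH]; simpl; [easy|].
  now rewrite IH, <- sum_plus.
Qed.

Lemma sum_f_R0_extend (f : nat -> R) (n N : nat) :
  (n <= N)%nat -> (forall i, (n < i)%nat -> f i = 0) ->
  sum_f_R0 f N = sum_f_R0 f n.
Proof.
  intros Hn Hf; induction Hn as [|N Hn IH]; [easy|].
  simpl; rewrite IH, Hf by lia; ring.
Qed.

Lemma sum_f_R0_shift (f : nat -> R) (n : nat) :
  sum_f_R0 f (S n) = f O + sum_f_R0 (fun i => f (S i)) n.
Proof. rewrite decomp_sum by lia; easy. Qed.

(** * Radii of convergence and uniqueness of expansions *)

Lemma CV_radius_gt_of_bounded (a : nat -> R) (r x M : R) :
  (forall n, Rabs (a n * r ^ n) <= M) -> Rabs x < r ->
  Rbar_lt (Rabs x) (CV_radius a).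
Proof.
  intros HM Hx; apply Rbar_lt_le_trans with (Finite r); [exact Hx|].
  apply (proj1 (CV_radius_bounded a)); now exists M.
Qed.

(** Outside the closed disk of convergence the terms do not even tend to 0. *)
Lemma CV_radius_ge_of_is_pseries (a : nat -> R) (x l : R) :
  is_pseries a x l -> Rbar_le (Rabs x) (CV_radius a).
Proof.
  intros H; apply Rbar_not_lt_le; intros Hlt.
  apply (CV_disk_outside _ _ Hlt), ex_series_lim_0.
  exists l; now apply is_pseries_R.
Qed.

(** Convergence at |x| + 1 leaves the room for the strict inequality that Cauchy products
    require. *)
Lemma CV_radius_entire (a : nat -> R) (f : R -> R) (x : R) :
  (forall t, is_pseries a t (f t)) -> Rbar_lt (Rabs x) (CV_radius a).
Proof.
  intros H.
  apply Rbar_lt_le_trans with (Finite (Rabs (Rabs x + 1))).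
  - simpl; rewrite (Rabs_pos_eq (Rabs x + 1)); pose proof (Rabs_pos x); lra.
  - exact (CV_radius_ge_of_is_pseries _ _ _ (H _)).
Qed.

Lemma CV_radius_pos_of_locally (a : nat -> R) (f : R -> R) :
  locally 0 (fun t => is_pseries a t (f t)) -> Rbar_lt 0 (CV_radius a).
Proof.
  intros [e He]; pose proof (cond_pos e) as Hpos.
  assert (Habs : Rabs (e / 2) = e / 2) by (apply Rabs_pos_eq; lra).
  apply Rbar_lt_le_trans with (Finite (Rabs (e / 2))).
  - simpl; lra.
  - apply CV_radius_ge_of_is_pseries with (f (e / 2)), He.
    change (Rabs (e / 2 - 0) < e); rewrite Rminus_0_r; lra.
Qed.

Lemma egf_unique (a b : nat -> R) (f : R -> R) (n : nat) :
  locally 0 (egf_at a f) -> locally 0 (egf_at b f) -> a n = b n.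
Proof.
  intros Ha Hb.
  assert (H : a n / INR (fact n) = b n / INR (fact n)).
  { apply (PSeries_ext_recip (fun n => a n / INR (fact n))
             (fun n => b n / INR (fact n))).
    - exact (CV_radius_pos_of_locally _ f Ha).
    - exact (CV_radius_pos_of_locally _ f Hb).
    - generalize (filter_and _ _ Ha Hb); apply filter_imp; intros t [H1 H2].
      now rewrite (is_pseries_unique _ _ _ H1), (is_pseries_unique _ _ _ H2). }
  pose proof (INR_fact_neq_0 n).
  apply (Rmult_eq_reg_r (/ INR (fact n))); [exact H|].
  now apply Rinv_neq_0_compat.
Qed.

(** Since [b] satisfies [P], so does the sequence chosen by [epsilon]; both then expand [f] near 0
    and must agree. *)
Lemma the_seq_eq (P : (nat -> R) -> Prop) (f : R -> R) (b : nat -> R) (n : nat) :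
  (forall a, P a -> locally 0 (egf_at a f)) -> P b -> the_seq P n = b n.
Proof.
  intros HP Hb; apply egf_unique with f; apply HP; [|exact Hb].
  unfold the_seq; apply epsilon_spec; now exists b.
Qed.

Lemma locally_0_lt_ln2 : locally 0 (fun t => Rabs t < ln 2).
Proof.
  assert (H : 0 < ln 2) by (rewrite <- ln_1; apply ln_increasing; lra).
  exists (mkposreal _ H); intros t Ht.
  change (Rabs (t - 0) < ln 2) in Ht; now rewrite Rminus_0_r in Ht.
Qed.

Lemma two_minus_exp_pos (t : R) : t < ln 2 -> 0 < 2 - exp t.
Proof.
  intros H; apply exp_increasing in H; rewrite exp_ln in H; lra.
Qed.

(** * Expansions of 1, e^(xt) and e^t - 1 *)

Lemma is_pseries_one (t : R) : is_pseries (fun n => 0 ^ n) t 1.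
Proof.
  apply is_pseries_R.
  replace 1 with (/ (1 - 0)) by field.
  apply is_series_ext with (fun n => 0 ^ n).
  - intros [|n]; simpl; ring.
  - apply is_series_geom; rewrite Rabs_R0; lra.
Qed.

Lemma is_pseries_exp_mult (x t : R) :
  is_pseries (fun n => x ^ n / INR (fact n)) t (exp (x * t)).
Proof.
  apply is_pseries_R.
  apply is_series_ext with (fun n => / INR (fact n) * (x * t) ^ n).
  - intros n; unfold Rdiv.
    now rewrite Rpow_mult_distr, <- Rmult_assoc, (Rmult_comm (/ _)).
  - apply is_pseries_R, is_exp_Reals.
Qed.

(** As 0 ^ 0 = 1, the subtracted [0 ^ n] removes exactly the constant term of the exponential
    series. *)
Definition expm1_coef (n : nat) : R := / INR (fact n) - 0 ^ n.

Lemma is_pseries_expm1 (t : R) : is_pseries expm1_coef t (exp t - 1).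
Proof.
  exact (is_pseries_minus _ _ _ _ _ (is_exp_Reals t) (is_pseries_one t)).
Qed.

Lemma expm1_coef_0 : expm1_coef 0 = 0.
Proof. unfold expm1_coef; simpl; field. Qed.

Lemma expm1_coef_pos (n : nat) : 0 <= expm1_coef n.
Proof.
  destruct n as [|n]; [rewrite expm1_coef_0; lra|].
  unfold expm1_coef; rewrite pow_i by lia.
  pose proof (Rinv_0_lt_compat _ (INR_fact_lt_0 (S n))); lra.
Qed.

Lemma expm1_partial_sum_le (s : R) (n : nat) :
  0 <= s -> sum_f_R0 (fun k => expm1_coef k * s ^ k) n <= exp s - 1.
Proof.
  intros Hs.
  assert (H : sum_f_R0 (fun k => expm1_coef k * s ^ k) n =
              sum_f_R0 (fun k => s ^ k / INR (fact k)) n - 1).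
  { induction n as [|n IH].
    - unfold expm1_coef; simpl; field.
    - rewrite !tech5, IH; unfold expm1_coef, Rdiv; rewrite (pow_i (S n)) by lia; ring. }
  rewrite H; pose proof (exp_ge_taylor s n Hs); lra.
Qed.

(** * Powers of e^t - 1 and Stirling numbers *)

Fixpoint expm1_pow_coef (k : nat) : nat -> R :=
  match k with
  | O => fun n => 0 ^ n
  | S j => PS_mult expm1_coef (expm1_pow_coef j)
  end.

Lemma is_pseries_expm1_pow (k : nat) (t : R) :
  is_pseries (expm1_pow_coef k) t ((exp t - 1) ^ k).
Proof.
  revert t; induction k as [|k IH]; intros t; [apply is_pseries_one|].
  apply (is_pseries_mult expm1_coef (expm1_pow_coef k)).
  - apply is_pseries_expm1.
  - apply IH.
  - exact (CV_radius_entire _ _ t is_pseries_expm1).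
  - exact (CV_radius_entire _ _ t IH).
Qed.

(** e^t - 1 has no constant term, so its k-th power vanishes at 0 to order at least k. *)
Lemma expm1_pow_coef_small (k n : nat) :
  (n < k)%nat -> expm1_pow_coef k n = 0.
Proof.
  revert n; induction k as [|k IH]; intros n Hn; [lia|].
  simpl; unfold PS_mult; apply sum_eq_R0; intros [|j] Hj.
  - rewrite expm1_coef_0; ring.
  - rewrite IH by lia; ring.
Qed.

Lemma stirling2_expm1 (n k : nat) :
  stirling2 n k = INR (fact n) / INR (fact k) * expm1_pow_coef k n.
Proof.
  unfold stirling2.
  rewrite (the_seq_eq _ (fun t => (exp t - 1) ^ k / INR (fact k))
    (fun n => INR (fact n) / INR (fact k) * expm1_pow_coef k n)); [easy| |].
  - intros a [_ Ha]; exact (filter_forall _ Ha).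
  - split.
    + intros m Hm; rewrite expm1_pow_coef_small by exact Hm; ring.
    + intros t; unfold egf_at, Rdiv; rewrite (Rmult_comm (_ ^ k)).
      apply is_pseries_ext with (PS_scal (/ INR (fact k)) (expm1_pow_coef k)).
      * intros m; pose proof (INR_fact_neq_0 m); pose proof (INR_fact_neq_0 k).
        change (/ INR (fact k) * expm1_pow_coef k m =
          INR (fact m) * / INR (fact k) * expm1_pow_coef k m * / INR (fact m)).
        now field.
      * apply (is_pseries_scal (V := R_NormedModule));
          [apply Rmult_comm | apply is_pseries_expm1_pow].
Qed.

(** * Binomial coefficients of negative order *)

(* The coefficient of u^i in (1 - u)^(-m). *)
Definition negbin (m i : nat) : R :=
  falling (- INR m) i * (-1) ^ i / INR (fact i).

Lemma negbin_0_S (i : nat) : negbin 0 (S i) = 0.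
Proof.
  unfold negbin.
  assert (H : falling (- INR 0) (S i) = 0).
  { induction i as [|i IH]; [simpl; ring|].
    change (falling (- INR 0) (S i) * (- INR 0 - INR (S i)) = 0).
    rewrite IH; ring. }
  rewrite H; unfold Rdiv; ring.
Qed.

Lemma negbin_succ (m i : nat) :
  INR (S i) * negbin m (S i) = (INR m + INR i) * negbin m i.
Proof.
  unfold negbin; rewrite fact_simpl, mult_INR; simpl falling; simpl pow.
  pose proof (INR_fact_neq_0 i); pose proof (not_0_INR (S i) (Nat.neq_succ_0 i)).
  now field.
Qed.

(** Coefficient form of m (1 - u)^(-m-1) = (m + u d/du) (1 - u)^(-m). *)
Lemma negbin_absorb (m i : nat) :
  INR m * negbin (S m) i = (INR m + INR i) * negbin m i.
Proof.
  pose proof (S_INR m) as Em.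
  induction i as [|i IH]; [unfold negbin; simpl; field|].
  pose proof (not_0_INR (S i) (Nat.neq_succ_0 i)) as Hi.
  apply (Rmult_eq_reg_l (INR (S i))); [|exact Hi].
  pose proof (negbin_succ m i) as H1; pose proof (negbin_succ (S m) i) as H2.
  replace (INR (S i) * (INR m * negbin (S m) (S i)))
    with (INR m * (INR (S i) * negbin (S m) (S i))) by ring.
  replace (INR (S i) * ((INR m + INR (S i)) * negbin m (S i)))
    with ((INR m + INR (S i)) * (INR (S i) * negbin m (S i))) by ring.
  rewrite H1, H2, <- IH, Em, S_INR.
  replace (INR m * ((INR m + 1 + INR i) * negbin (S m) i))
    with ((INR m + 1 + INR i) * (INR m * negbin (S m) i)) by ring.
  rewrite IH; ring.
Qed.

(** Coefficient form of (1 - u)^(-m-1) = (1 - u)^(-m) + u (1 - u)^(-m-1). *)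
Lemma negbin_pascal (m i : nat) :
  negbin (S m) (S i) = negbin m (S i) + negbin (S m) i.
Proof.
  apply (Rmult_eq_reg_l (INR (S i))); [|apply not_0_INR; lia].
  rewrite Rmult_plus_distr_l, !negbin_succ, <- (negbin_absorb m i), !S_INR; ring.
Qed.

(** * Taylor expansion of (2 - e^t)^(-m) *)

(** The T_m(n) of the overview. Stopping at i = n loses nothing, because u^i contributes to t^n only
    for i <= n. *)
Definition geom_coef (m n : nat) : R :=
  sum_f_R0 (fun i => negbin m i * expm1_pow_coef i n) n.

Lemma geom_coef_extend (m n N : nat) :
  (n <= N)%nat ->
  geom_coef m n = sum_f_R0 (fun i => negbin m i * expm1_pow_coef i n) N.
Proof.
  intros H; symmetry; apply sum_f_R0_extend; [exact H|].
  intros i Hi; rewrite expm1_pow_coef_small by exact Hi; ring.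
Qed.

Lemma geom_coef_0 (n : nat) : geom_coef 0 n = 0 ^ n.
Proof.
  rewrite (geom_coef_extend 0 n (S n)), sum_f_R0_shift by lia.
  rewrite sum_eq_R0; [unfold negbin; simpl; field|].
  intros i _; rewrite negbin_0_S; ring.
Qed.

(** Multiplication by u turns u^i into u^(i+1). Extending all inner sums to the common bound n
    allows the two sums to be exchanged. *)
Lemma expm1_mult_geom_coef (m n : nat) :
  PS_mult expm1_coef (geom_coef m) n =
  sum_f_R0 (fun i => negbin m i * expm1_pow_coef (S i) n) n.
Proof.
  unfold PS_mult.
  rewrite (sum_eq _ (fun k => sum_f_R0 (fun i =>
    expm1_coef k * (negbin m i * expm1_pow_coef i (n - k))) n)).
  - rewrite sum_f_R0_exchange; apply sum_eq; intros i _.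
    simpl; unfold PS_mult; rewrite scal_sum; apply sum_eq; intros k _; ring.
  - intros k _; rewrite (geom_coef_extend m (n - k) n) by lia.
    rewrite scal_sum; apply sum_eq; intros i _; ring.
Qed.

Lemma geom_coef_S (m n : nat) :
  geom_coef (S m) n = geom_coef m n + PS_mult expm1_coef (geom_coef (S m)) n.
Proof.
  rewrite expm1_mult_geom_coef, !(geom_coef_extend _ n (S n)), !sum_f_R0_shift by lia.
  (* The terms at i = 0 agree by conversion, since [falling _ 0] is 1; Pascal's rule handles the
     others. *)
  rewrite Rplus_assoc, <- sum_plus; f_equal.
  apply sum_eq; intros i _; rewrite negbin_pascal; ring.
Qed.

Lemma geom_coef_bounded (m : nat) (s : R) :
  0 <= s < ln 2 -> exists M, forall n, Rabs (geom_coef m n * s ^ n) <= M.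
Proof.
  intros [Hs0 Hs]; induction m as [|m [K HK]].
  - exists 1; intros [|n]; rewrite geom_coef_0.
    + simpl; rewrite Rabs_pos_eq; lra.
    + rewrite pow_i, Rmult_0_l, Rabs_R0 by lia; lra.
  - pose proof (two_minus_exp_pos s Hs) as Hpos.
    (* L is the fixed point of L = K + L (e^s - 1), nonnegative because e^s < 2; the recurrence
       therefore preserves the bound L. *)
    set (L := K / (2 - exp s)).
    assert (HL : 0 <= L).
    { apply Rdiv_le_0_compat; [|exact Hpos].
      apply Rle_trans with (2 := HK O), Rabs_pos. }
    assert (EL : K + L * (exp s - 1) = L) by (unfold L; field; lra).
    exists L; intros n; induction n as [n IH] using lt_wf_ind.
    rewrite geom_coef_S, Rmult_plus_distr_r, <- EL.
    eapply Rle_trans; [apply Rabs_triang|]; apply Rplus_le_compat; [apply HK|].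
    unfold PS_mult; rewrite Rmult_comm, scal_sum.
    eapply Rle_trans; [apply Rsum_abs|].
    apply Rle_trans with (L * sum_f_R0 (fun k => expm1_coef k * s ^ k) n).
    (* The term k = 0, which would involve index n itself, vanishes with [expm1_coef 0]; the others
       fall under the strong induction hypothesis. *)
    + rewrite scal_sum; apply sum_Rle; intros [|k] Hk.
      * rewrite expm1_coef_0, !Rmult_0_l, Rabs_R0; lra.
      * replace (s ^ n) with (s ^ S k * s ^ (n - S k)) by
          (rewrite <- pow_add; f_equal; lia).
        replace (expm1_coef (S k) * geom_coef (S m) (n - S k) *
                 (s ^ S k * s ^ (n - S k)))
          with ((expm1_coef (S k) * s ^ S k) *
                (geom_coef (S m) (n - S k) * s ^ (n - S k))) by ring.
        assert (Hu : 0 <= expm1_coef (S k) * s ^ S k)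
          by (apply Rmult_le_pos; [apply expm1_coef_pos | now apply pow_le]).
        rewrite Rabs_mult, (Rabs_pos_eq _ Hu).
        apply Rmult_le_compat_l; [exact Hu | apply IH; lia].
    + apply Rmult_le_compat_l; [exact HL | now apply expm1_partial_sum_le].
Qed.

Lemma geom_coef_radius (m : nat) (t : R) :
  Rabs t < ln 2 -> Rbar_lt (Rabs t) (CV_radius (geom_coef m)).
Proof.
  intros Ht; pose proof (Rabs_pos t).
  (* The midpoint lies strictly between |t| and ln 2. *)
  destruct (geom_coef_bounded m ((Rabs t + ln 2) / 2)) as [M HM]; [lra|].
  apply (CV_radius_gt_of_bounded _ _ _ _ HM); lra.
Qed.

Lemma is_pseries_geom_coef (m : nat) (t : R) :
  Rabs t < ln 2 -> is_pseries (geom_coef m) t (/ (2 - exp t) ^ m).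
Proof.
  intros Ht.
  assert (Hpos : 0 < 2 - exp t)
    by (apply two_minus_exp_pos; pose proof (Rle_abs t); lra).
  induction m as [|m IH].
  - apply is_pseries_ext with (fun n => 0 ^ n).
    + intros n; now rewrite geom_coef_0.
    + simpl; rewrite Rinv_1; apply is_pseries_one.
  - pose proof (PSeries_correct _ _ (CV_radius_inside _ _ (geom_coef_radius (S m) t Ht)))
      as HS.
    (* Summing the coefficient recurrence gives a linear equation for the unknown sum, solvable
       because 2 - e^t is nonzero. *)
    assert (E : PSeries (geom_coef (S m)) t =
      / (2 - exp t) ^ m + (exp t - 1) * PSeries (geom_coef (S m)) t).
    { apply is_pseries_unique.
      apply is_pseries_ext with
        (PS_plus (geom_coef m) (PS_mult expm1_coef (geom_coef (S m)))).
      - intros n; symmetry; apply geom_coef_S.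
      - apply (is_pseries_plus (V := R_NormedModule)); [exact IH|].
        apply is_pseries_mult; [apply is_pseries_expm1 | exact HS | |].
        + exact (CV_radius_entire _ _ t is_pseries_expm1).
        + now apply geom_coef_radius. }
    replace (/ (2 - exp t) ^ S m) with (PSeries (geom_coef (S m)) t); [exact HS|].
    assert (Hm : (2 - exp t) ^ m <> 0) by (apply pow_nonzero; lra).
    apply (Rmult_eq_reg_l (2 - exp t)); [|lra].
    replace ((2 - exp t) * / (2 - exp t) ^ S m) with (/ (2 - exp t) ^ m)
      by (simpl; field; split; [exact Hm | lra]).
    lra.
Qed.

(** * Multiplication by e^(xt) and the Stirling sums *)

(** The sequence generated by c (2 - e^t)^(-m) e^(xt); the factor c lets it serve both families of
    polynomials. *)
Definition geom_exp_seq (c : R) (m : nat) (x : R) (n : nat) : R :=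
  c * (INR (fact n) * PS_mult (geom_coef m) (fun j => x ^ j / INR (fact j)) n).

Lemma egf_geom_exp_seq (c : R) (m : nat) (x t : R) :
  Rabs t < ln 2 ->
  egf_at (geom_exp_seq c m x) (fun t => c / (2 - exp t) ^ m * exp (x * t)) t.
Proof.
  intros Ht; unfold egf_at, Rdiv; rewrite Rmult_assoc.
  apply is_pseries_ext with
    (PS_scal c (PS_mult (geom_coef m) (fun j => x ^ j / INR (fact j)))).
  - intros n; unfold geom_exp_seq; pose proof (INR_fact_neq_0 n).
    set (p := PS_mult (geom_coef m) (fun j => x ^ j / INR (fact j)) n).
    change (c * p = c * (INR (fact n) * p) * / INR (fact n)); now field.
  - apply (is_pseries_scal (V := R_NormedModule)); [apply Rmult_comm|].
    apply is_pseries_mult.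
    + now apply is_pseries_geom_coef.
    + apply is_pseries_exp_mult.
    + now apply geom_coef_radius.
    + exact (CV_radius_entire _ _ t (is_pseries_exp_mult x)).
Qed.

Lemma fact_mult_geom_coef (m n : nat) :
  INR (fact n) * geom_coef m n =
  sum_f_R0 (fun i => falling (- INR m) i * (-1) ^ i * stirling2 n i) n.
Proof.
  unfold geom_coef; rewrite scal_sum; apply sum_eq; intros i _.
  rewrite stirling2_expm1; unfold negbin; pose proof (INR_fact_neq_0 i); now field.
Qed.

Lemma geom_exp_seq_stirling (c : R) (m n : nat) (x : R) :
  geom_exp_seq c m x n =
  c * sum_f_R0 (fun k => Binomial.C n k *
    sum_f_R0 (fun i => falling (- INR m) i * (-1) ^ i * stirling2 k i) k
      * x ^ (n - k)) n.
Proof.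
  unfold geom_exp_seq; f_equal; unfold PS_mult.
  rewrite scal_sum; apply sum_eq; intros k _.
  rewrite <- fact_mult_geom_coef; unfold Binomial.C.
  pose proof (INR_fact_neq_0 k); pose proof (INR_fact_neq_0 (n - k)); now field.
Qed.

(** * Identification of the Fubini-type and Apostol-Euler polynomials *)

Lemma fubini_poly_geom_exp (alpha n : nat) (x : R) :
  fubini_poly alpha n x = geom_exp_seq (2 ^ alpha) (2 * alpha) x n.
Proof.
  apply the_seq_eq with
    (fun t => 2 ^ alpha / (2 - exp t) ^ (2 * alpha) * exp (x * t)).
  - intros a Ha; generalize locally_0_lt_ln2; apply filter_imp; exact Ha.
  - intros t; apply egf_geom_exp_seq.
Qed.

Lemma apostol_euler_geom_exp (alpha n : nat) (x : R) :
  apostol_euler (2 * alpha) n x (- 1 / 2) =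
  geom_exp_seq (2 ^ (4 * alpha)) (2 * alpha) x n.
Proof.
  apply the_seq_eq with
    (fun t => (2 / (- 1 / 2 * exp t + 1)) ^ (2 * alpha) * exp (x * t)).
  - easy.
  - generalize locally_0_lt_ln2; apply filter_imp; intros t Ht.
    assert (Hpos : 0 < 2 - exp t)
      by (apply two_minus_exp_pos; pose proof (Rle_abs t); lra).
    pose proof (egf_geom_exp_seq (2 ^ (4 * alpha)) (2 * alpha) x t Ht) as H.
    unfold egf_at in *.
    replace ((2 / (- 1 / 2 * exp t + 1)) ^ (2 * alpha))
      with (2 ^ (4 * alpha) / (2 - exp t) ^ (2 * alpha)); [exact H|].
    (* 2 / (1 - e^t / 2) = 4 / (2 - e^t), whose power 2 alpha has numerator 2^(4 alpha). *)
    replace (2 / (- 1 / 2 * exp t + 1)) with (2 ^ 2 * / (2 - exp t))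
      by (field; lra).
    rewrite Rpow_mult_distr, pow_inv, <- pow_mult.
    replace (2 * (2 * alpha))%nat with (4 * alpha)%nat by lia; easy.
Qed.

Theorem theorem3p2 (alpha n : nat) (x : R) :
  fubini_poly alpha n x =
    2 ^ alpha * sum_f_R0 (fun k => Binomial.C n k *
      sum_f_R0 (fun i => falling (- 2 * INR alpha) i * (-1) ^ i * stirling2 k i) k
        * x ^ (n - k)) n
  /\ fubini_number alpha n =
    2 ^ alpha *
      sum_f_R0 (fun i => falling (- 2 * INR alpha) i * (-1) ^ i * stirling2 n i) n
  /\ apostol_euler (2 * alpha) n x (- 1 / 2) =
    2 ^ (4 * alpha) * sum_f_R0 (fun k => Binomial.C n k *
      sum_f_R0 (fun i => falling (- 2 * INR alpha) i * (-1) ^ i * stirling2 k i) k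
        * x ^ (n - k)) n.
Proof.
  replace (- 2 * INR alpha) with (- INR (2 * alpha)) by (rewrite mult_INR; simpl; ring).
  split; [|split].
  - now rewrite fubini_poly_geom_exp, geom_exp_seq_stirling.
  - unfold fubini_number; rewrite fubini_poly_geom_exp; unfold geom_exp_seq.
    rewrite <- fact_mult_geom_coef; do 2 f_equal; unfold PS_mult.
    (* At x = 0 only k = n survives in the Cauchy product, with 0 ^ 0 = 1. *)
    destruct n as [|n]; [simpl; field|].
    rewrite tech5, sum_eq_R0.
    + rewrite Nat.sub_diag; simpl; field.
    + intros k Hk; rewrite pow_i by lia; unfold Rdiv; ring.
  - now rewrite apostol_euler_geom_exp, geom_exp_seq_stirling.
Qed.
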